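(* Let $K$ be a commutative ring and let $H$ be a Hopf algebra over $K$ that is flat as a $K$-module. Let $R$ be a right $H$-comodule algebra with structure map $\rho_R: R\to R\otimes_K H$, written $\rho_R(r)=r_{(0)}\otimes r_{(1)}$. Let $A=R[x_1;\sigma_1,\delta_1]\cdots[x_n;\sigma_n,\delta_n]$ be an iterated skew polynomial ring over $R$, with all $\sigma_i$ and $\delta_i$ being $K$-linear, such that, for each $1\le i\le n$, $\sigma_i$ and $\delta_i$ are morphisms of right $H$-comodules. Then $A$ is also a right $H$-comodule algebra with structure map $\rho_A:A\to A\otimes_K H$ given by $$\rho_A\left(\sum_{i=0}^m r_iX_i\right)=\sum_{i=0}^m (r_i)_{(0)}X_i\otimes (r_i)_{(1)},\qquad r_i\in R,\ X_i\in\operatorname{Mon}(A),\ 0\le i\le m.$$ Moreover, $A^{\operatorname{co}H}=R^{\operatorname{co}H}[x_1;\sigma_1,\delta_1]\cdots[x_n;\sigma_n,\delta_n]$, where, for every $1\le i\le n$, $\sigma_i$ and $\delta_i$ are considered restricted to $R^{\operatorname{co}H}[x_1;\sigma_1,\delta_1]\cdots[x_{i-1};\sigma_{i-1},\delta_{i-1}]$.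
   Context: All rings and ring morphisms are unital; algebras are associative; tensor products are over $K$; $K$-modules are assumed non-zero. Skew polynomial rings: for a ring $R$ and a ring endomorphism $\sigma$ of $R$, a $\sigma$-derivation is an additive map $\delta:R\to R$ with $\delta(rs)=\sigma(r)\delta(s)+\delta(r)s$ for all $r,s\in R$. The skew polynomial ring $R[x;\sigma,\delta]$ is a ring containing $R$ as a (proper) unital subring and with a distinguished element $x$ such that it is a free left $R$-module with basis $\{1,x,x^2,\dots\}$ and $xr=\sigma(r)x+\delta(r)$ for all $r\in R$. When $R$ is a $K$-algebra and $\sigma,\delta$ are $K$-linear, it is a $K$-algebra containing $R$ as a subalgebra. An iterated skew polynomial ring $R[x_1;\sigma_1,\delta_1]\cdots[x_n;\sigma_n,\delta_n]$ is obtained by repeating this construction; for each $i$, with $A_{i-1}=R[x_1;\sigma_1,\delta_1]\cdots[x_{i-1};\sigma_{i-1},\delta_{i-1}]$ ($A_0=R$), $\sigma_i$ is an endomorphism of $A_{i-1}$ and $\delta_i$ is a $\sigma_i$-derivation of $A_{i-1}$. The set $\operatorname{Mon}(A)=\{x_1^{\alpha_1}\cdots x_n^{\alpha_n}:(\alpha_1,\dots,\alpha_n)\in\mathbb{N}^n\}$ (with $0\in\mathbb N$) is a left $R$-basis of $A$. Comodule algebras: a right $H$-comodule is a $K$-module $N$ with a $K$-linear map $\rho:N\to N\otimes H$ such that $(\operatorname{id}_N\otimes\Delta)\rho=(\rho\otimes\operatorname{id}_H)\rho$ and $(\operatorname{id}_N\otimes\varepsilon)\rho(n)=n\otimes 1$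 for all $n\in N$; Heyneman–Sweedler notation (implicit summation) $\rho(n)=n_{(0)}\otimes n_{(1)}$ is used. A $K$-linear map $g:N\to L$ of right $H$-comodules is a comodule morphism if $\rho_L(g(n))=g(n_{(0)})\otimes n_{(1)}$ for all $n\in N$. A right $H$-comodule algebra is a $K$-algebra $B$ that is a right $H$-comodule whose structure map satisfies $\rho(ab)=a_{(0)}b_{(0)}\otimes a_{(1)}b_{(1)}$ and $\rho(1_B)=1_B\otimes 1_H$. Its coinvariants are $B^{\operatorname{co}H}=\{b\in B:\rho(b)=b\otimes 1\}$, a subalgebra. The condition that $\sigma_i,\delta_i$ are $H$-comodule morphisms refers to the right $H$-comodule structure on $A_{i-1}$ induced recursively from that of $R$, namely $rX\mapsto r_{(0)}X\otimes r_{(1)}$ for $r\in R$ and $X=x_1^{\alpha_1}\cdots x_{i-1}^{\alpha_{i-1}}$. The notation $R^{\operatorname{co}H}[x_1;\sigma_1,\delta_1]\cdots[x_i;\sigma_i,\delta_i]$ denotes the set of all left $R^{\operatorname{co}H}$-linear combinations of the monomials $x_1^{\alpha_1}\cdots x_i^{\alpha_i}$ inside $A_i$. *)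

(* Defs.v *)
From HB Require Import structures.
From mathcomp Require Import all_boot all_algebra.
From mathcomp Require Import boolp classical_sets.

Set Implicit Arguments.
Unset Strict Implicit.
Unset Printing Implicit Defensive.

Import GRing.Theory.

Local Open Scope quotient_scope.
Local Open Scope ring_scope.

Section TensorDef.
Context {K : comNzRingType} (M N : lmodType K).

(* A formal sum of pure tensors is a list of pairs. [tens_eq] is the least
   congruence making concatenation commutative and pairs K-balanced and
   biadditive. *)
Inductive tens_eq : seq (M * N) -> seq (M * N) -> Prop :=
| tens_refl s : tens_eq s s
| tens_sym s t : tens_eq s t -> tens_eq t s
| tens_trans s t u : tens_eq s t -> tens_eq t u -> tens_eq s u
| tens_cat s s' t t' :
    tens_eq s s' -> tens_eq t t' -> tens_eq (s ++ t) (s' ++ t')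
| tens_comm s t : tens_eq (s ++ t) (t ++ s)
| tens_zero n : tens_eq [:: (0, n)] [::]
| tens_addl m m' n : tens_eq [:: (m + m', n)] [:: (m, n); (m', n)]
| tens_addr m n n' : tens_eq [:: (m, n + n')] [:: (m, n); (m, n')]
| tens_bal (a : K) m n : tens_eq [:: (a *: m, n)] [:: (m, a *: n)].

Definition tens_eqb (s t : seq (M * N)) : bool := `[< tens_eq s t >].

Lemma tens_eqb_refl : reflexive tens_eqb.
Proof. by move=> s; apply/asboolP; exact: tens_refl. Qed.

Lemma tens_eqb_sym : symmetric tens_eqb.
Proof. by move=> s t; apply/asboolP/asboolP; exact: tens_sym. Qed.

Lemma tens_eqb_trans : transitive tens_eqb.
Proof.
by move=> t s u /asboolP h1 /asboolP h2; apply/asboolP; exact: tens_trans h2.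
Qed.

Canonical tens_equiv := EquivRel tens_eqb
  tens_eqb_refl tens_eqb_sym tens_eqb_trans.

Definition tensor : Type := {eq_quot tens_equiv}.

HB.instance Definition _ := Choice.on tensor.
HB.instance Definition _ := EqQuotient.on tensor.

Definition tens_class (s : seq (M * N)) : tensor := \pi_tensor s.

Lemma tens_classP s t : tens_class s = tens_class t <-> tens_eq s t.
Proof.
by split=> [/eqmodP/asboolP|h] //; apply/eqmodP/asboolP.
Qed.

Lemma tens_repr s : tens_eq (repr (tens_class s)) s.
Proof. by apply/tens_classP; rewrite /tens_class reprK. Qed.

Lemma tens_classK t : tens_class (repr t) = t.
Proof. exact: reprK. Qed.

Definition tens_add (t u : tensor) : tensor := tens_class (repr t ++ repr u).

Lemma tens_addE s t : tens_add (tens_class s) (tens_class t) = tens_class (s ++ t).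
Proof. by apply/tens_classP/tens_cat; exact: tens_repr. Qed.

Definition tens_sopp (s : seq (M * N)) := [seq (- p.1, p.2) | p <- s].
Definition tens_sscale (a : K) (s : seq (M * N)) :=
  [seq (a *: p.1, p.2) | p <- s].

Lemma tens_oppK s : tens_eq (tens_sopp s ++ s) [::].
Proof.
elim: s => [|[m n] s IH]; first exact: tens_refl.
apply: (@tens_trans _ ([:: (- m, n); (m, n)] ++ (tens_sopp s ++ s))).
  apply: (@tens_cat [:: (- m, n)] [:: (- m, n)]); first exact: tens_refl.
  rewrite -/(tens_sopp s ++ (m, n) :: s) -cat_rcons -cats1.
  apply: (@tens_cat _ ((m, n) :: tens_sopp s)); last exact: tens_refl.
  exact: (tens_comm _ [:: _]).
rewrite -[X in tens_eq _ X]cat0s; apply: tens_cat => //.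
apply: tens_trans (tens_sym (tens_addl _ _ _)) _.
by rewrite addNr; exact: tens_zero.
Qed.

Lemma tens_sscale_eq a s t :
  tens_eq s t -> tens_eq (tens_sscale a s) (tens_sscale a t).
Proof.
elim=> {s t} [s|s t _|s t u _ + _|s s' t t' _ + _|s t|n|m m' n|m n n'|b m n] /=.
- exact: tens_refl.
- exact: tens_sym.
- exact: tens_trans.
- by rewrite /tens_sscale !map_cat; exact: tens_cat.
- by rewrite /tens_sscale !map_cat; exact: tens_comm.
- by rewrite scaler0; exact: tens_zero.
- by rewrite scalerDr; exact: tens_addl.
- exact: tens_addr.
- by rewrite scalerA mulrC -scalerA; exact: tens_bal.
Qed.

Definition tens_opp (t : tensor) : tensor := tens_class (tens_sopp (repr t)).
Definition tens_scale (a : K) (t : tensor) : tensor :=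
  tens_class (tens_sscale a (repr t)).

Lemma tens_scaleE a s : tens_scale a (tens_class s) = tens_class (tens_sscale a s).
Proof. by apply/tens_classP/tens_sscale_eq; exact: tens_repr. Qed.

Lemma tens_addA : associative tens_add.
Proof.
move=> t u v; rewrite -(tens_classK t) -(tens_classK u) -(tens_classK v).
by rewrite !tens_addE catA.
Qed.

Lemma tens_addC : commutative tens_add.
Proof. by move=> t u; apply/tens_classP; exact: tens_comm. Qed.

Lemma tens_add0 : left_id (tens_class [::]) tens_add.
Proof. by move=> t; rewrite -{1}(tens_classK t) tens_addE tens_classK. Qed.

Lemma tens_addN : left_inverse (tens_class [::]) tens_opp tens_add.
Proof.
move=> t; rewrite -{2}(tens_classK t) tens_addE.
by apply/tens_classP; exact: tens_oppK.
Qed.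

HB.instance Definition _ :=
  GRing.isZmodule.Build tensor tens_addA tens_addC tens_add0 tens_addN.

Definition tpure (m : M) (n : N) : tensor := tens_class [:: (m, n)].

Lemma tens_class_nil : tens_class [::] = 0. Proof. by []. Qed.

Lemma tens_class_cat s t : tens_class (s ++ t) = tens_class s + tens_class t.
Proof. by rewrite -tens_addE. Qed.

Lemma tens_class_sum s : tens_class s = \sum_(p <- s) tpure p.1 p.2.
Proof.
elim: s => [|[m n] s IH]; first by rewrite big_nil.
by rewrite big_cons -IH -cat1s tens_class_cat.
Qed.

Lemma tensE t : t = \sum_(p <- repr t) tpure p.1 p.2.
Proof. by rewrite -tens_class_sum tens_classK. Qed.

Lemma tens_ind (P : tensor -> Prop) :
  P 0 -> (forall t u, P t -> P u -> P (t + u)) ->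
  (forall m n, P (tpure m n)) -> forall t, P t.
Proof. by move=> P0 PD Pp t; rewrite (tensE t); elim/big_ind: _. Qed.

Lemma tpureDl m m' n : tpure (m + m') n = tpure m n + tpure m' n.
Proof. by rewrite -tens_class_cat; apply/tens_classP; exact: tens_addl. Qed.

Lemma tpureDr m n n' : tpure m (n + n') = tpure m n + tpure m n'.
Proof. by rewrite -tens_class_cat; apply/tens_classP; exact: tens_addr. Qed.

Lemma tpure_bal (a : K) m n : tpure (a *: m) n = tpure m (a *: n).
Proof. by apply/tens_classP; exact: tens_bal. Qed.

Lemma tpure0l n : tpure 0 n = 0.
Proof. by apply/tens_classP; exact: tens_zero. Qed.

Lemma tens_scaleDr a t u :
  tens_scale a (t + u) = tens_scale a t + tens_scale a u.
Proof.
rewrite -(tens_classK t) -(tens_classK u) -tens_class_cat !tens_scaleE.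
by rewrite -tens_class_cat /tens_sscale map_cat.
Qed.

Lemma tens_scale_pure a m n : tens_scale a (tpure m n) = tpure (a *: m) n.
Proof. by rewrite /tpure tens_scaleE. Qed.

Lemma tens_scale0 a : tens_scale a 0 = 0.
Proof. by rewrite -tens_class_nil tens_scaleE. Qed.

Lemma tens_scaleA a b t : tens_scale a (tens_scale b t) = tens_scale (a * b) t.
Proof.
elim/tens_ind: t => [|t u IHt IHu|m n].
- by rewrite !tens_scale0.
- by rewrite !tens_scaleDr IHt IHu.
- by rewrite !tens_scale_pure scalerA.
Qed.

Lemma tens_scale1 : left_id 1 tens_scale.
Proof.
move=> t; elim/tens_ind: t => [|t u IHt IHu|m n].
- by rewrite !tens_scale0.
- by rewrite !tens_scaleDr IHt IHu.
- by rewrite !tens_scale_pure scale1r.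
Qed.

Lemma tens_scaleDl t : {morph tens_scale^~ t : a b / a + b}.
Proof.
move=> a b; elim/tens_ind: t => [|t u IHt IHu|m n].
- by rewrite !tens_scale0 addr0.
- by rewrite !tens_scaleDr IHt IHu addrACA.
- by rewrite !tens_scale_pure scalerDl tpureDl.
Qed.

HB.instance Definition _ := GRing.Zmodule_isLmodule.Build K tensor
  tens_scaleA tens_scale1 tens_scaleDr tens_scaleDl.

Lemma tpureZl (a : K) m n : tpure (a *: m) n = a *: tpure m n.
Proof. by rewrite -tens_scale_pure. Qed.

Lemma tpureZr (a : K) m n : tpure m (a *: n) = a *: tpure m n.
Proof. by rewrite -tpure_bal tpureZl. Qed.

Lemma tpure0r m : tpure m 0 = 0.
Proof. by rewrite -(scale0r 0) tpureZr scale0r. Qed.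

End TensorDef.

Notation "M '\otimes' N" := (tensor M N) (at level 40, left associativity).
Notation "m '\ot' n" := (tpure m n) (at level 40, left associativity).

Section TensorLift.
Context {K : comNzRingType} (M N P : lmodType K).

Definition is_bilinear (f : M -> N -> P) : Prop :=
  (forall n, linear (f^~ n)) /\ (forall m, linear (f m)).

(* [tlift f] is the linear map induced by [f]. It is meaningful only when [f]
   is bilinear, since only then is it independent of the representative. *)
Definition tlift (f : M -> N -> P) (t : M \otimes N) : P :=
  \sum_(p <- repr t) f p.1 p.2.

Variables (f : M -> N -> P) (fbil : is_bilinear f).

Let fDl m m' n : f (m + m') n = f m n + f m' n.
Proof. by have := fbil.1 n 1 m m'; rewrite !scale1r. Qed.
Let fDr m n n' : f m (n + n') = f m n + f m n'.
Proof. by have := fbil.2 m 1 n n'; rewrite !scale1r. Qed.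
Let f0l n : f 0 n = 0.
Proof. by apply: (@addrI _ (f 0 n)); rewrite -fDl !addr0. Qed.
Let f0r m : f m 0 = 0.
Proof. by apply: (@addrI _ (f m 0)); rewrite -fDr !addr0. Qed.
Let fZl a m n : f (a *: m) n = a *: f m n.
Proof. by have := fbil.1 n a m 0; rewrite f0l !addr0. Qed.
Let fZr a m n : f m (a *: n) = a *: f m n.
Proof. by have := fbil.2 m a n 0; rewrite f0r !addr0. Qed.

Lemma tlift_class s : tlift f (tens_class s) = \sum_(p <- s) f p.1 p.2.
Proof.
rewrite /tlift; move: (repr _) (tens_repr s) => s'.
elim=> {s s'} [s|s t _|s t u _ IHs _ IHt|s s' t t' _ IHs _ IHt|s t|n|m m' n
  |m n n'|b m n] //=.
- by rewrite IHs.
- by rewrite !big_cat /= IHs IHt.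
- by rewrite !big_cat /= addrC.
- by rewrite big_seq1 big_nil /= f0l.
- by rewrite !big_cons !big_nil /= !addr0 fDl.
- by rewrite !big_cons !big_nil /= !addr0 fDr.
- by rewrite !big_seq1 /= fZl fZr.
Qed.

Lemma tlift_pure m n : tlift f (m \ot n) = f m n.
Proof. by rewrite tlift_class big_seq1. Qed.

Lemma tlift_linear : linear (tlift f).
Proof.
move=> a t u; rewrite -(tens_classK t) -(tens_classK u).
have -> : a *: tens_class (repr t) = tens_class (tens_sscale a (repr t)).
  by rewrite -tens_scaleE.
rewrite -tens_class_cat !tlift_class big_cat /= big_map scaler_sumr.
by congr (_ + _); apply: eq_bigr => p _; rewrite fZl.
Qed.

End TensorLift.

Section TensorMap.
Context {K : comNzRingType} (M N M' N' : lmodType K).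
Variables (f : {linear M -> M'}) (g : {linear N -> N'}).

Definition tmap (t : M \otimes N) : M' \otimes N' :=
  tlift (fun m n => f m \ot g n) t.

Lemma tmap_bilinear : is_bilinear (fun m n => f m \ot g n).
Proof.
split=> [n a m m'|m a n n'] /=.
- by rewrite linearP tpureDl tpureZl.
- by rewrite linearP tpureDr tpureZr.
Qed.

Lemma tmap_pure m n : tmap (m \ot n) = f m \ot g n.
Proof. exact/tlift_pure/tmap_bilinear. Qed.

Lemma tmap_linear : linear tmap.
Proof. exact/tlift_linear/tmap_bilinear. Qed.

HB.instance Definition _ :=
  GRing.isLinear.Build K (M \otimes N) (M' \otimes N') *:%R tmap tmap_linear.

End TensorMap.

Section TensorAssoc.
Context {K : comNzRingType} (M N P : lmodType K).

Definition tassoc (t : (M \otimes N) \otimes P) : M \otimes (N \otimes P) :=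
  tlift (fun mn p => tlift (fun m n => m \ot (n \ot p)) mn) t.

Lemma tassoc_inner (p : P) : is_bilinear (fun (m : M) (n : N) => m \ot (n \ot p)).
Proof.
split=> [n a m m'|m a n n'] /=.
- by rewrite tpureDl tpureZl.
- by rewrite tpureDl tpureZl tpureDr tpureZr.
Qed.

Lemma tassoc_outer :
  is_bilinear (fun mn (p : P) => tlift (fun (m : M) (n : N) => m \ot (n \ot p)) mn).
Proof.
split=> [p|t a p p']; first exact/tlift_linear/tassoc_inner.
rewrite /tlift scaler_sumr -big_split /=; apply: eq_bigr => q _.
by rewrite tpureDr tpureZr tpureDr tpureZr.
Qed.

Lemma tassoc_pure m n p : tassoc ((m \ot n) \ot p) = m \ot (n \ot p).
Proof.
by rewrite /tassoc (tlift_pure tassoc_outer) (tlift_pure (tassoc_inner p)).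
Qed.

Lemma tassoc_linear : linear tassoc.
Proof. exact/tlift_linear/tassoc_outer. Qed.

HB.instance Definition _ := GRing.isLinear.Build K
  ((M \otimes N) \otimes P) (M \otimes (N \otimes P)) *:%R tassoc tassoc_linear.

End TensorAssoc.

(* The ring structure is possibly zero: a tensor product of nonzero algebras
   may vanish. *)
Section TensorAlg.
Context {K : comNzRingType} (A B : algType K).

Definition tmul (t u : A \otimes B) : A \otimes B :=
  tlift (fun a b => tlift (fun a' b' => (a * a') \ot (b * b')) u) t.

Lemma tmul_inner (a : A) (b : B) :
  is_bilinear (fun (a' : A) (b' : B) => (a * a') \ot (b * b')).
Proof.
split=> [b' k x y|a' k x y] /=.
- by rewrite mulrDr -scalerAr tpureDl tpureZl.
- by rewrite mulrDr -scalerAr tpureDr tpureZr.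
Qed.

Lemma tmul_outer (u : A \otimes B) :
  is_bilinear (fun (a : A) (b : B) => tlift (fun a' b' => (a * a') \ot (b * b')) u).
Proof.
split=> [b k x y|a k x y] /=;
  rewrite /tlift scaler_sumr -big_split /=; apply: eq_bigr => q _.
- by rewrite mulrDl -scalerAl tpureDl tpureZl.
- by rewrite mulrDl -scalerAl tpureDr tpureZr.
Qed.

Lemma tmul_pure a b a' b' :
  tmul (a \ot b) (a' \ot b') = (a * a') \ot (b * b').
Proof.
by rewrite /tmul (tlift_pure (tmul_outer _)) (tlift_pure (tmul_inner a b)).
Qed.

Lemma tmulDl : left_distributive tmul +%R.
Proof.
move=> t t' u; rewrite -[t in LHS]scale1r.
by rewrite /tmul (tlift_linear (tmul_outer u)) scale1r.
Qed.

Lemma tmulDr : right_distributive tmul +%R.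
Proof.
move=> t u u'; rewrite /tmul /tlift -big_split /=; apply: eq_bigr => p _.
rewrite -[u in LHS]scale1r.
by have := tlift_linear (tmul_inner p.1 p.2) 1 u u'; rewrite [X in _ = X + _]scale1r.
Qed.

Lemma tmul0l u : tmul 0 u = 0.
Proof. by apply: (@addrI _ (tmul 0 u)); rewrite -tmulDl !addr0. Qed.

Lemma tmul0r t : tmul t 0 = 0.
Proof. by apply: (@addrI _ (tmul t 0)); rewrite -tmulDr !addr0. Qed.

Lemma tmulA : associative tmul.
Proof.
move=> t u v; elim/(@tens_ind K A B): t => [|t t' IH IH'|a b].
- by rewrite !tmul0l.
- by rewrite !tmulDl IH IH'.
elim/(@tens_ind K A B): u => [|u u' IH IH'|a' b'].
- by rewrite tmul0r !tmul0l tmul0r.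
- by rewrite tmulDl !tmulDr IH IH' tmulDl.
elim/(@tens_ind K A B): v => [|v v' IH IH'|a'' b''].
- by rewrite !tmul0r.
- by rewrite !tmulDr IH IH'.
- by rewrite !tmul_pure !mulrA.
Qed.

Lemma tmul1l : left_id (1 \ot 1) tmul.
Proof.
move=> u; elim/(@tens_ind K A B): u => [|u u' IH IH'|a b].
- by rewrite tmul0r.
- by rewrite tmulDr IH IH'.
- by rewrite tmul_pure !mul1r.
Qed.

Lemma tmul1r : right_id (1 \ot 1) tmul.
Proof.
move=> u; elim/(@tens_ind K A B): u => [|u u' IH IH'|a b].
- by rewrite tmul0l.
- by rewrite tmulDl IH IH'.
- by rewrite tmul_pure !mulr1.
Qed.

HB.instance Definition _ := GRing.Zmodule_isPzRing.Build (A \otimes B)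
  tmulA tmul1l tmul1r tmulDl tmulDr.

End TensorAlg.

Definition flat {K : comNzRingType} (F : lmodType K) : Prop :=
  forall (M N : lmodType K) (f : {linear M -> N}),
    injective f ->
    injective (tmap f (idfun : {linear F -> F})).

Record hopfAlgebra (K : comNzRingType) := HopfAlgebra {
  hopf_alg :> algType K;
  comul : {linear hopf_alg -> hopf_alg \otimes hopf_alg};
  counit : {linear hopf_alg -> K^o};
  antipode : {linear hopf_alg -> hopf_alg};
  comulA : forall h,
    tmap idfun comul (comul h) = tassoc (tmap comul idfun (comul h));
  counitl : forall h, tmap counit idfun (comul h) = (1 : K^o) \ot h;
  counitr : forall h, tmap idfun counit (comul h) = h \ot (1 : K^o);
  comul_monoid_morphism : monoid_morphism comul;
  counit_monoid_morphism : monoid_morphism (counit : hopf_alg -> K);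
  antipodel : forall h,
    tlift (fun a b => antipode a * b) (comul h) = (counit h : K)%:A;
  antipoder : forall h,
    tlift (fun a b => a * antipode b) (comul h) = (counit h : K)%:A }.

Arguments comul {K} H : rename.
Arguments counit {K} H : rename.
Arguments antipode {K} H : rename.

Section Comodules.
Context {K : comNzRingType} (H : hopfAlgebra K).

Definition is_comodule (N : lmodType K) (rho : {linear N -> N \otimes H}) : Prop :=
  (forall n, tmap idfun (comul H) (rho n) = tassoc (tmap rho idfun (rho n))) /\
  (forall n, tmap idfun (counit H) (rho n) = n \ot (1 : K^o)).

Definition is_comodule_morphism (N L : lmodType K)
    (rhoN : {linear N -> N \otimes H}) (rhoL : {linear L -> L \otimes H})
    (g : {linear N -> L}) : Prop :=
  forall n, rhoL (g n) = tmap g idfun (rhoN n).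

Definition is_comodule_algebra (B : algType K)
    (rho : {linear B -> B \otimes H}) : Prop :=
  is_comodule rho /\ monoid_morphism rho.

Definition coinvariants (N : lmodType K) (rho : {linear N -> N \otimes H}) : set N :=
  [set b | rho b = b \ot 1]%classic.

End Comodules.

Definition skew_derivation (R : pzRingType) (sigma delta : R -> R) : Prop :=
  forall r s, delta (r * s) = sigma r * delta s + delta r * s.

(* For noncommuting coefficients [p.[x]] is [\sum_i p`_i * x ^+ i], so
   [skew_basis] says that the powers of [skew_var] form a left basis. It forces
   [skew_inj] to be injective and not surjective. *)
Record skew_poly {K : comNzRingType} (R : algType K)
    (sigma : {lrmorphism R -> R}) (delta : {linear R -> R}) := SkewPoly {
  skew_alg :> algType K;
  skew_inj : {lrmorphism R -> skew_alg};
  skew_var : skew_alg;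
  skew_basis : forall s : skew_alg,
    exists! p : {poly R}, s = (map_poly skew_inj p).[skew_var];
  skew_comm : forall r : R,
    skew_var * skew_inj r
      = skew_inj (sigma r) * skew_var + skew_inj (delta r) }.

Section SkewCoaction.
Context {K : comNzRingType} (R : algType K).
Context (sigma : {lrmorphism R -> R}) (delta : {linear R -> R}).
Variable S : skew_poly sigma delta.

Definition skew_coef (s : S) : {poly R} := sval (cid (skew_basis s)).

Lemma skew_coefK s : (map_poly (skew_inj S) (skew_coef s)).[skew_var S] = s.
Proof. by rewrite /skew_coef; case: cid => p [/= <-]. Qed.

Lemma skew_evalK p : skew_coef (map_poly (skew_inj S) p).[skew_var S] = p.
Proof. by rewrite /skew_coef; case: cid => q [/= _]; apply. Qed.

Lemma skew_coef_linear (a : K) s t i :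
  (skew_coef (a *: s + t))`_i = a *: (skew_coef s)`_i + (skew_coef t)`_i.
Proof.
have -> : skew_coef (a *: s + t) = (a%:A)%:P * skew_coef s + skew_coef t.
  rewrite -[RHS]skew_evalK rmorphD /= hornerD skew_coefK; congr skew_coef.
  congr (_ + _); rewrite mul_polyC map_polyZ /= hornerZ skew_coefK.
  by rewrite rmorph_alg mulr_algl.
by rewrite coefD coefCM mulr_algl.
Qed.

Context (H : hopfAlgebra K) (rho : {linear R -> R \otimes H}).

(* The coaction [r x^j |-> r_(0) x^j \ot r_(1)] induced from that of [R]. Here
   [a \o* f] is [fun r => f r * a]. *)
Definition skew_coaction_fun (s : S) : S \otimes H :=
  \sum_(j < size (skew_coef s))
    tmap (skew_var S ^+ j \o* skew_inj S) idfun (rho (skew_coef s)`_j).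

Lemma skew_coaction_funE n s : (size (skew_coef s) <= n)%N ->
  skew_coaction_fun s =
  \sum_(j < n) tmap (skew_var S ^+ j \o* skew_inj S) idfun (rho (skew_coef s)`_j).
Proof.
move=> le_n; rewrite /skew_coaction_fun.
rewrite (big_ord_widen _ (fun j : nat => tmap (skew_var S ^+ j \o* skew_inj S) idfun
   (rho (skew_coef s)`_j)) le_n) big_mkcond /=; apply: eq_bigr => j _.
by case: ltnP => // le_j; rewrite nth_default // !linear0.
Qed.

Lemma skew_coaction_linear : linear skew_coaction_fun.
Proof.
move=> a s t; set n := maxn (size (skew_coef (a *: s + t)))
  (maxn (size (skew_coef s)) (size (skew_coef t))).
rewrite !(@skew_coaction_funE n) ?leq_max ?leqnn ?orbT //.
rewrite scaler_sumr -big_split /=; apply: eq_bigr => j _.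
by rewrite skew_coef_linear !linearP.
Qed.

HB.instance Definition _ := GRing.isLinear.Build K S (S \otimes H) *:%R
  skew_coaction_fun skew_coaction_linear.

Definition skew_coaction : {linear S -> S \otimes H} := skew_coaction_fun.

End SkewCoaction.

Section Iterated.
Context {K : comNzRingType} (R : algType K).

(* [iterated_skew_poly n A] is the structure of an [n]-fold iterated skew
   polynomial ring over [R] on [A]. *)
Inductive iterated_skew_poly : nat -> algType K -> Type :=
| iter_base : iterated_skew_poly 0 R
| iter_step (n : nat) (A : algType K) (T : iterated_skew_poly n A)
    (sigma : {lrmorphism A -> A}) (delta : {linear A -> A})
    (sd : skew_derivation sigma delta) (E : skew_poly sigma delta) :
    iterated_skew_poly n.+1 E.

Fixpoint iter_inj n A (T : iterated_skew_poly n A) : {lrmorphism R -> A} :=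
  match T in iterated_skew_poly n A return {lrmorphism R -> A} with
  | iter_base => idfun
  | iter_step _ _ T _ _ _ E => skew_inj E \o iter_inj T
  end.

(* [iter_mon T alpha] is [x_1 ^+ alpha 0 * ... * x_n ^+ alpha (n - 1)]. *)
Fixpoint iter_mon n A (T : iterated_skew_poly n A) : ('I_n -> nat) -> A :=
  match T in iterated_skew_poly n A return ('I_n -> nat) -> A with
  | iter_base => fun=> 1
  | iter_step n _ T _ _ _ E => fun alpha =>
      skew_inj E (iter_mon T (fun i => alpha (widen_ord (leqnSn n) i)))
        * skew_var E ^+ alpha ord_max
  end.

Definition Mon n A (T : iterated_skew_poly n A) : set A :=
  [set iter_mon T alpha | alpha in [set: 'I_n -> nat]]%classic.

(* [stages T P]: [P] holds of [A_(i-1)], [sigma_i], [delta_i] for each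
   [1 <= i <= n]; the index passed to [P] is [i - 1]. *)
Fixpoint stages n A (T : iterated_skew_poly n A)
    (P : forall i B, iterated_skew_poly i B ->
           {lrmorphism B -> B} -> {linear B -> B} -> Prop) : Prop :=
  match T with
  | iter_base => True
  | iter_step i B T sigma delta _ _ => stages T P /\ P i B T sigma delta
  end.

Fixpoint iter_coaction (H : hopfAlgebra K) (rho : {linear R -> R \otimes H})
    n A (T : iterated_skew_poly n A) : {linear A -> A \otimes H} :=
  match T in iterated_skew_poly n A return {linear A -> A \otimes H} with
  | iter_base => rho
  | iter_step _ _ T _ _ _ E => skew_coaction E (iter_coaction rho T)
  end.

Definition mon_span (C : set R) n A (T : iterated_skew_poly n A) : set A :=
  [set a | exists (m : nat) (r : 'I_m -> R) (X : 'I_m -> A),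
     [/\ forall i, C (r i), forall i, Mon T (X i) &
         a = \sum_(i < m) iter_inj T (r i) * X i]]%classic.

End Iterated.

(* Main.v *)
Require Import Defs.
From HB Require Import structures.
From mathcomp Require Import all_boot all_algebra.
From mathcomp Require Import boolp classical_sets.

Set Implicit Arguments.
Unset Strict Implicit.
Unset Printing Implicit Defensive.

Import GRing.Theory.
Local Open Scope ring_scope.

(** In a single extension [E = B[x; sigma, delta]] the coaction is
[rho_E (i b * x ^+ j) = tmap (x ^+ j \o* i) idfun (rho b)], where [i] embeds
[B] in [E]. Everything reduces to such terms by linearity ([skew_ind]).

The comodule axioms for [rho_E] follow from those of [rho] by pushing [tmap]
through them. Multiplicativity is where the hypotheses on [sigma] and [delta]
enter. Multiplying by [i b] on the left is compatible with the coactions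
because [rho] is multiplicative; multiplying by [x] on the left is compatible
because [x * i c = i (sigma c) * x + i (delta c)] and both [sigma] and [delta]
commute with the coactions, so that [rho_E (x * s) = (x \ot 1) * rho_E s]
([skew_coaction_var]). Hence [rho_E] is multiplicative.

For the coinvariants, the map reading off the coefficient of [x ^+ j] is a
comodule morphism [E -> B] ([skew_nth_comodule_morphism]), and comodule
morphisms preserve coinvariants. An element of [E] is thus coinvariant only if
all its coefficients are, and induction on the number of variables brings the
coefficients down to coinvariants of [R] ([iter_coinvariants]). Since [sigma]
and [delta] are comodule morphisms too, they preserve the coinvariants of each
stage, which are the spans of the monomials over the coinvariants of [R]. *)

(** * Functoriality of the tensor product *)

Section TensorMaps.
Context {K : comNzRingType}.

(** The composites are given up to pointwise equality, because the bundled linear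
maps that occur in practice agree only as functions. *)
Lemma tmap_tmap (M N M' N' M'' N'' : lmodType K)
    (f : {linear M -> M'}) (g : {linear N -> N'})
    (f' : {linear M' -> M''}) (g' : {linear N' -> N''})
    (f'' : {linear M -> M''}) (g'' : {linear N -> N''}) t :
  f' \o f =1 f'' -> g' \o g =1 g'' ->
  tmap f' g' (tmap f g t) = tmap f'' g'' t.
Proof.
move=> ef eg; elim/(@tens_ind K M N): t => [|t u IHt IHu|m n].
- by rewrite !linear0.
- by rewrite !linearD /= IHt IHu.
- by rewrite !tmap_pure -ef -eg.
Qed.

Lemma tmap_id (M N : lmodType K) (f : {linear M -> M}) (g : {linear N -> N}) t :
  f =1 id -> g =1 id -> tmap f g t = t.
Proof.
move=> ef eg; elim/(@tens_ind K M N): t => [|t u IHt IHu|m n].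
- by rewrite linear0.
- by rewrite linearD /= IHt IHu.
- by rewrite tmap_pure ef eg.
Qed.

Lemma tassoc_tmap (M N P M' N' P' : lmodType K) (f : {linear M -> M'})
    (g : {linear N -> N'}) (h : {linear P -> P'}) t :
  tassoc (tmap (tmap f g) h t) = tmap f (tmap g h) (tassoc t).
Proof.
elim/(@tens_ind K (M \otimes N) P): t => [|t u IHt IHu|m p].
- by rewrite !linear0.
- by rewrite !linearD /= IHt IHu.
elim/(@tens_ind K M N): m => [|t u IHt IHu|m n].
- by rewrite tpure0l !linear0.
- by rewrite tpureDl !linearD /= IHt IHu.
- by rewrite tmap_pure /= tmap_pure !tassoc_pure !tmap_pure /= tmap_pure.
Qed.

Lemma tens_mulE (A B : algType K) (a a' : A) (b b' : B) :
  (a \ot b) * (a' \ot b') = (a * a') \ot (b * b').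
Proof. exact: tmul_pure. Qed.

End TensorMaps.

(** * The coaction on one skew polynomial extension *)

Section SkewStep.
Context {K : comNzRingType} (B : algType K).
Context (sigma : {lrmorphism B -> B}) (delta : {linear B -> B}).
Context (E : skew_poly sigma delta).
Local Notation i := (skew_inj E).
Local Notation x := (skew_var E).

Lemma skew_sumE (s : E) :
  s = \sum_(j < size (skew_coef s)) i (skew_coef s)`_j * x ^+ j.
Proof.
rewrite -{1}(skew_coefK s) (@horner_coef_wide _ (size (skew_coef s)));
  last exact: size_poly.
by apply: eq_bigr => j _; rewrite coef_map.
Qed.

Lemma skew_ind (P : E -> Prop) : P 0 -> (forall s t, P s -> P t -> P (s + t)) ->
  (forall b j, P (i b * x ^+ j)) -> forall s, P s.
Proof. by move=> P0 PD Pm s; rewrite (skew_sumE s); elim/big_ind: _. Qed.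

Lemma skew_coef_mon b j : skew_coef (i b * x ^+ j) = b *: 'X^j.
Proof.
rewrite -[RHS](skew_evalK E); congr skew_coef.
by rewrite map_polyZ /= map_polyXn hornerZ hornerXn.
Qed.

(** The coefficients as bundled linear maps, so that [tmap] applies to them. *)
Definition skew_nth (j : nat) (s : E) : B := (skew_coef s)`_j.

Lemma skew_nth_linear j : linear (skew_nth j).
Proof. by move=> a s t; exact: skew_coef_linear. Qed.

HB.instance Definition _ j :=
  GRing.isLinear.Build K E B *:%R (skew_nth j) (skew_nth_linear j).

Lemma skew_nth_mon j b k : skew_nth j (i b * x ^+ k) = b *+ (j == k).
Proof. by rewrite /skew_nth skew_coef_mon coefZ coefXn mulr_natr. Qed.

Context (H : hopfAlgebra K) (rho : {linear B -> B \otimes H}).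
Local Notation rhoE := (skew_coaction E rho).

Lemma skew_coaction_mon b j :
  rhoE (i b * x ^+ j) = tmap (x ^+ j \o* i) idfun (rho b).
Proof.
have le_j : (size (skew_coef (i b * x ^+ j)) <= j.+1)%N.
  by rewrite skew_coef_mon (leq_trans (size_scale_leq _ _)) ?size_polyXn.
rewrite [LHS](skew_coaction_funE rho le_j) big_ord_recr /= big1 => [|k _].
  by rewrite add0r skew_coef_mon coefZ coefXn eqxx mulr1.
by rewrite skew_coef_mon coefZ coefXn ltn_eqF ?mulr0 ?linear0.
Qed.

(** On [i b * x ^+ j], both axioms are the images of the axioms for [b] under
tensor products of [f = (x ^+ j \o* i)] with identities. *)
Lemma skew_coaction_comodule : is_comodule rho -> is_comodule rhoE.
Proof.
move=> [rhoA rho1]; split=> s.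
  elim/skew_ind: s => [|s t IHs IHt|b j]; first by rewrite !linear0.
    by rewrite !linearD /= IHs IHt.
  rewrite skew_coaction_mon; set f := (_ \o* _ : {linear _ -> _}).
  rewrite (tmap_tmap (f'' := f) (g'' := comul H)) //.
  rewrite -(tmap_tmap (f := idfun) (g := comul H) (f' := f) (g' := idfun)) //.
  (* [rho_E \o f] is [tmap f idfun \o rho], so both sides become [f] applied to
     the first leg of the iterated coaction of [b]. *)
  rewrite rhoA.
  rewrite (tmap_tmap (f'' := tmap f idfun \o rho) (g'' := idfun)) //; last first.
    by move=> c /=; rewrite skew_coaction_mon.
  rewrite -(tmap_tmap (f := rho) (g := idfun) (f' := tmap f idfun) (g' := idfun)) //.
  rewrite tassoc_tmap.
  elim/(@tens_ind K B (H \otimes H)): (tassoc _) => [|t u IHt IHu|m n].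
  - by rewrite !linear0.
  - by rewrite !linearD /= IHt IHu.
  - by rewrite !tmap_pure /= tmap_id.
elim/skew_ind: s => [|s t IHs IHt|b j]; first by rewrite !linear0 tpure0l.
  by rewrite !linearD /= IHs IHt tpureDl.
rewrite skew_coaction_mon; set f := (_ \o* _ : {linear _ -> _}).
rewrite (tmap_tmap (f'' := f) (g'' := counit H)) //.
rewrite -(tmap_tmap (f := idfun) (g := counit H) (f' := f) (g' := idfun)) //.
by rewrite rho1 tmap_pure.
Qed.

(** Half of the multiplicativity of [rhoE]: the left factors [i b] and [x] are
treated separately, and for [i b] it comes from the multiplicativity of
[rho]. *)
Lemma skew_coaction_mull (b : B) (s : E) : {morph rho : c d / c * d} ->
  rhoE (i b * s) = tmap i idfun (rho b) * rhoE s.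
Proof.
move=> rhoM; elim/skew_ind: s => [|s t IHs IHt|c j].
- by rewrite mulr0 !linear0 mulr0.
- by rewrite mulrDr !linearD /= IHs IHt mulrDr.
rewrite mulrA -rmorphM !skew_coaction_mon rhoM.
elim/(@tens_ind K B H): (rho b) => [|t u IHt IHu|m h].
- by rewrite mul0r !linear0 mul0r.
- by rewrite mulrDl !linearD /= IHt IHu mulrDl.
elim/(@tens_ind K B H): (rho c) => [|t u IHt IHu|m' h'].
- by rewrite mulr0 !linear0 mulr0.
- by rewrite mulrDr !linearD /= IHt IHu mulrDr.
by rewrite tens_mulE !tmap_pure tens_mulE /= rmorphM mulrA.
Qed.

(** On [i c * x ^+ j], moving [x] past [i c] produces [sigma c] and [delta c].
Colinearity turns their coactions into [sigma] and [delta] applied to the first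
leg of [rho c], and the commutation rule in [E], read backwards on that leg,
reassembles the left factor [x]. *)
Lemma skew_coaction_var (s : E) :
  is_comodule_morphism rho rho sigma -> is_comodule_morphism rho rho delta ->
  rhoE (x * s) = (x \ot 1) * rhoE s.
Proof.
move=> hs hd; elim/skew_ind: s => [|s t IHs IHt|c j].
- by rewrite mulr0 !linear0 mulr0.
- by rewrite mulrDr !linearD /= IHs IHt mulrDr.
rewrite mulrA skew_comm mulrDl -mulrA -exprS linearD !skew_coaction_mon hs hd.
elim/(@tens_ind K B H): (rho c) => [|t u IHt IHu|m h].
- by rewrite !linear0 mulr0 addr0.
- by rewrite !linearD /= mulrDr -IHt -IHu addrACA.
rewrite !tmap_pure tens_mulE -tpureDl mul1r /=.
by rewrite mulrA skew_comm mulrDl -mulrA -exprS.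
Qed.

Lemma skew_coaction_comodule_algebra :
  is_comodule_morphism rho rho sigma -> is_comodule_morphism rho rho delta ->
  is_comodule_algebra rho -> is_comodule_algebra rhoE.
Proof.
move=> hs hd [hrho [rho1 rhoM]]; split; first exact: skew_coaction_comodule.
split=> [|s t].
  have -> : 1 = i 1 * x ^+ 0 :> E by rewrite rmorph1 mulr1.
  by rewrite skew_coaction_mon rho1 [LHS]tmap_pure /= rmorph1 mulr1.
elim/skew_ind: s => [|s u IHs IHu|b j].
- by rewrite mul0r !linear0 mul0r.
- by rewrite mulrDl !linearD /= IHs IHu mulrDl.
have rhoX k u : rhoE (x ^+ k * u) = (x ^+ k \ot 1) * rhoE u.
  elim: k => [|k IHk]; first by rewrite !mul1r.
  by rewrite exprS -mulrA skew_coaction_var // IHk mulrA tens_mulE mulr1.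
rewrite -mulrA (skew_coaction_mull _ (x ^+ j * t)) // rhoX mulrA; congr (_ * _).
rewrite skew_coaction_mon.
elim/(@tens_ind K B H): (rho b) => [|v w IHv IHw|m h].
- by rewrite !linear0 mul0r.
- by rewrite !linearD /= mulrDl IHv IHw.
- by rewrite !tmap_pure tens_mulE mulr1.
Qed.

(** The coaction acts on the coefficients and leaves the powers of [x] alone.
This gives the linear independence needed for the coinvariants: comparing the
coefficients in [E \otimes H] is done by applying [tmap (skew_nth j) idfun]. *)
Lemma skew_nth_comodule_morphism j : is_comodule_morphism rhoE rho (skew_nth j).
Proof.
move=> s; elim/skew_ind: s => [|s t IHs IHt|b k]; first by rewrite !linear0.
  by rewrite !linearD /= IHs IHt.
rewrite skew_coaction_mon /= skew_nth_mon linearMn.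
elim/(@tens_ind K B H): (rho b) => [|t u IHt IHu|m h].
- by rewrite !linear0 mul0rn.
- by rewrite !linearD /= mulrnDl IHt IHu.
- by rewrite !tmap_pure /= skew_nth_mon; case: eqP => _; rewrite ?tpure0l.
Qed.

End SkewStep.

Lemma comodule_morphism_coinvariants (K : comNzRingType) (H : hopfAlgebra K)
    (N L : lmodType K) (rhoN : {linear N -> N \otimes H})
    (rhoL : {linear L -> L \otimes H}) (g : {linear N -> L}) (b : N) :
  is_comodule_morphism rhoN rhoL g ->
  coinvariants rhoN b -> coinvariants rhoL (g b).
Proof. by move=> hg hb; rewrite /coinvariants /= hg hb tmap_pure. Qed.

(** * Iterated extensions *)

Section Iterated.
Context {K : comNzRingType} (R : algType K).

Section MonSpan.
Context (C : set R) (n : nat) (A : algType K) (T : iterated_skew_poly R n A).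

Lemma mon_span0 : mon_span C T 0.
Proof.
exists 0%N, (fun=> 0), (fun=> 0); split; try by case.
by rewrite big_ord0.
Qed.

Lemma mon_spanD a b : mon_span C T a -> mon_span C T b -> mon_span C T (a + b).
Proof.
move=> [m [r [X [hr hX ->]]]] [m' [r' [X' [hr' hX' ->]]]].
pose glue U (f : 'I_m -> U) (f' : 'I_m' -> U) (k : 'I_(m + m')) :=
  match split k with inl k => f k | inr k => f' k end.
exists (m + m')%N, (glue _ r r'), (glue _ X X').
split=> [k|k|]; try by rewrite /glue; case: split.
rewrite big_split_ord /=; congr (_ + _); apply: eq_bigr => k _; rewrite /glue.
  by rewrite -/(unsplit (inl k)) unsplitK.
by rewrite -/(unsplit (inr k)) unsplitK.
Qed.

Lemma mon_span_mon r X : C r -> Mon T X -> mon_span C T (iter_inj T r * X).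
Proof. by exists 1%N, (fun=> r), (fun=> X); rewrite big_ord1. Qed.

End MonSpan.

Lemma Mon_step n (A : algType K) (T : iterated_skew_poly R n A)
    (sigma : {lrmorphism A -> A}) (delta : {linear A -> A})
    (sd : skew_derivation sigma delta) (E : skew_poly sigma delta) X j :
  Mon T X -> Mon (iter_step T sd E) (skew_inj E X * skew_var E ^+ j).
Proof.
move=> [alpha _ <-].
(* [ord_max] indexes the new variable; the others are the [lift ord_max k]. *)
exists (fun k : 'I_n.+1 => if unlift ord_max k is Some k'
  then alpha k' else j) => //=.
rewrite unlift_none; congr (skew_inj E (iter_mon T _) * _).
apply/funext => k.
have -> : widen_ord (leqnSn n) k = lift ord_max k.
  by apply: val_inj; rewrite /= /bump leqNgt ltn_ord.
by rewrite liftK.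
Qed.

(** The span over [C] may be built one variable at a time, because a monomial in
the first [n] variables times a power of the last variable is again a
monomial. *)
Lemma mon_span_step (C : set R) n (A : algType K) (T : iterated_skew_poly R n A)
    (sigma : {lrmorphism A -> A}) (delta : {linear A -> A})
    (sd : skew_derivation sigma delta) (E : skew_poly sigma delta) b j :
  mon_span C T b -> mon_span C (iter_step T sd E) (skew_inj E b * skew_var E ^+ j).
Proof.
move=> [m [r [X [hr hX ->]]]]; rewrite linear_sum mulr_suml.
elim/big_ind: _ => [|s t|k _]; [exact: mon_span0|exact: mon_spanD|].
by rewrite rmorphM -mulrA; apply: (mon_span_mon (hr k)); exact: Mon_step.
Qed.

Context (H : hopfAlgebra K) (rho : {linear R -> R \otimes H}).

Definition comodule_stages n A (T : iterated_skew_poly R n A) : Prop :=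
  stages T (fun i B (TB : iterated_skew_poly R i B)
      (sigma : {lrmorphism B -> B}) (delta : {linear B -> B}) =>
    is_comodule_morphism (iter_coaction rho TB) (iter_coaction rho TB) sigma /\
    is_comodule_morphism (iter_coaction rho TB) (iter_coaction rho TB) delta).

Lemma iter_coaction_comodule_algebra n A (T : iterated_skew_poly R n A) :
  is_comodule_algebra rho -> comodule_stages T ->
  is_comodule_algebra (iter_coaction rho T).
Proof.
move=> hrho; elim: n A / T => [//|n A T IH sigma delta sd E [hT [hs hd]]].
by apply: skew_coaction_comodule_algebra => //; exact: IH.
Qed.

Lemma iter_coaction_mon n A (T : iterated_skew_poly R n A) r X : Mon T X ->
  iter_coaction rho T (iter_inj T r * X) =
  tmap (X \o* iter_inj T) idfun (rho r).
Proof.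
elim: n A / T X => [|n A T IH sigma delta sd E] X [alpha _ <-] /=.
  by rewrite mulr1 tmap_id // => b /=; rewrite mulr1.
set X' := iter_mon T _.
rewrite mulrA -rmorphM skew_coaction_mon IH; last by eexists.
by apply: tmap_tmap => // b /=; rewrite rmorphM mulrA.
Qed.

(** Combinations of monomials with coinvariant coefficients are coinvariant by
the formula for the coaction. Conversely, the coefficients of a coinvariant
element with respect to the last variable are coinvariant one stage below,
where the induction hypothesis applies. *)
Lemma iter_coinvariants n A (T : iterated_skew_poly R n A) :
  coinvariants (iter_coaction rho T) = mon_span (coinvariants rho) T.
Proof.
apply/seteqP; split=> [|_ [m [r [X [hr hX ->]]]]]; last first.
  rewrite /coinvariants /= linear_sum /=.
  elim/big_rec2: _ => [|k t s _ ->]; first by rewrite tpure0l.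
  by rewrite tpureDl iter_coaction_mon // hr tmap_pure.
elim: n A / T => [|n A T IH sigma delta sd E] s hs.
  rewrite -[s]mulr1; apply: (mon_span_mon (T := iter_base R)) => //.
  by exists (fun=> 0%N).
rewrite (skew_sumE s); elim/big_ind: _ => [|u v|j _].
- exact: mon_span0.
- exact: mon_spanD.
apply/mon_span_step/IH.
exact: comodule_morphism_coinvariants (skew_nth_comodule_morphism _ j) hs.
Qed.

Lemma stages_mon_span n A (T : iterated_skew_poly R n A) : comodule_stages T ->
  stages T (fun i B (TB : iterated_skew_poly R i B)
      (sigma : {lrmorphism B -> B}) (delta : {linear B -> B}) =>
    forall b, mon_span (coinvariants rho) TB b ->
      mon_span (coinvariants rho) TB (sigma b) /\
      mon_span (coinvariants rho) TB (delta b)).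
Proof.
elim: n A / T => [//|n A T IH sigma delta sd E [hT [hs hd]]].
split=> [|b]; first exact: IH.
by rewrite -iter_coinvariants => hb; split; apply: comodule_morphism_coinvariants hb.
Qed.

End Iterated.

Theorem mainTheorem2 (K : comNzRingType) (H : hopfAlgebra K) (Hflat : flat H)
    (R : algType K) (rhoR : {linear R -> R \otimes H})
    (HR : is_comodule_algebra rhoR)
    (n : nat) (A : algType K) (T : iterated_skew_poly R n A)
    (HT : stages T (fun i B (TB : iterated_skew_poly R i B)
             (sigma : {lrmorphism B -> B}) (delta : {linear B -> B}) =>
           is_comodule_morphism (iter_coaction rhoR TB) (iter_coaction rhoR TB)
             sigma /\
           is_comodule_morphism (iter_coaction rhoR TB) (iter_coaction rhoR TB)
             delta)) :
  [/\ is_comodule_algebra (iter_coaction rhoR T),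
      forall (m : nat) (r : 'I_m.+1 -> R) (X : 'I_m.+1 -> A),
        (forall i, Mon T (X i)) ->
        iter_coaction rhoR T (\sum_(i < m.+1) iter_inj T (r i) * X i)
        = \sum_(i < m.+1) tmap (X i \o* iter_inj T) idfun (rhoR (r i)),
      coinvariants (iter_coaction rhoR T) = mon_span (coinvariants rhoR) T &
      stages T (fun i B (TB : iterated_skew_poly R i B)
           (sigma : {lrmorphism B -> B}) (delta : {linear B -> B}) =>
         forall b, mon_span (coinvariants rhoR) TB b ->
           mon_span (coinvariants rhoR) TB (sigma b) /\
           mon_span (coinvariants rhoR) TB (delta b))].
Proof.
split.
- exact: iter_coaction_comodule_algebra.
- move=> m r X hX; rewrite linear_sum; apply: eq_bigr => k _.
  exact: iter_coaction_mon.
- exact: iter_coinvariants.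
- exact: stages_mon_span.
Qed.
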